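(* Let $H$ be a fixed unicyclic connected planar graph, let $A<1$ be a constant, and let $m(n)$ be non-negative integers with $m(n)\le An$ for all $n$. Then \[ \limsup_{n\to\infty}\mathbf{P}[P_{n,m}\text{ has a subgraph isomorphic to } H]<1. \]
   Context: $\mathcal{P}(n,m)$ denotes the set of all (simple, labelled) planar graphs on the vertex set $\{1,2,\ldots,n\}$ with exactly $m$ edges, and $P_{n,m}$ denotes a graph chosen uniformly at random from $\mathcal{P}(n,m)$. A connected graph $H$ is unicyclic if $e(H)=|H|$ (number of edges equals number of vertices), i.e. it contains exactly one cycle. A copy of $H$ in a graph means any (not necessarily induced) subgraph isomorphic to $H$. *)

(* Defs.v *)
From HB Require Import structures.
From mathcomp Require Import all_boot all_order all_algebra.
From mathcomp Require Import all_classical all_reals all_analysis.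
Import Order.TTheory GRing.Theory Num.Theory.
Import numFieldNormedType.Exports.

Set Implicit Arguments.
Unset Strict Implicit.
Unset Printing Implicit Defensive.

Local Open Scope classical_set_scope.
Local Open Scope ring_scope.

(* A simple graph on the vertex set V is given by its set of edges, each edge
   being a two-element set of vertices. *)
Definition simple_graph (V : finType) (E : {set {set V}}) : bool :=
  [forall e in E, #|e| == 2%N].

Definition adjacent (V : finType) (E : {set {set V}}) : rel V :=
  fun x y => [set x; y]%SET \in E.

(* The graph without vertices is not connected. *)
Definition connected_graph (V : finType) (E : {set {set V}}) : bool :=
  (0 < #|V|)%N && [forall x : V, forall y : V, connect (adjacent E) x y].

Definition unicyclic (V : finType) (E : {set {set V}}) : bool :=
  connected_graph E && (#|E| == #|V|).

(* A drawing in the plane R * R: p places the vertices, and c e, restricted to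
   [0, 1], parametrizes the simple arc which represents the edge e.  The
   values of c outside of E and [0, 1] are irrelevant. *)
Definition plane_drawing (R : realType) (V : finType) (E : {set {set V}})
    (p : V -> R * R) (c : {set V} -> R -> R * R) : Prop :=
  [/\ injective p,
      forall e, e \in E ->
        [/\ {within `[0, 1], continuous (c e)},
            {in `[0, 1] &, injective (c e)},
            [set c e 0; c e 1] = p @` [set` e] &
            (c e @` `]0, 1[) `&` range p = set0] &
      forall e e', e \in E -> e' \in E -> e != e' ->
        (c e @` `]0, 1[) `&` (c e' @` `]0, 1[) = set0].

Definition planar (R : realType) (V : finType) (E : {set {set V}}) : Prop :=
  exists (p : V -> R * R) (c : {set V} -> R -> R * R), plane_drawing E p c.

(* The vertices 1, ..., n are represented by the elements of 'I_n. *)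
Definition planar_graphs (R : realType) (n m : nat) : {set {set {set 'I_n}}} :=
  [set E : {set {set 'I_n}} |
    [&& simple_graph E, #|E| == m & `[< planar R E >]]]%SET.

(* A copy need not be induced. *)
Definition has_copy (V W : finType) (H : {set {set V}}) (G : {set {set W}}) :
    bool :=
  [exists f : {ffun V -> W}, injectiveb f && [forall e in H, f @: e \in G]].

(* Probability of the event Q for a uniformly random element of
   planar_graphs R n m (0 if there is no such graph). *)
Definition Pr_planar (R : realType) (n m : nat) (Q : pred {set {set 'I_n}}) :
    R :=
  #|[set G in planar_graphs R n m | Q G]%SET|%:R / #|planar_graphs R n m|%:R.

(* Main.v *)
Require Import Defs.
From mathcomp Require Import all_boot zify.

(* Since m <= A n, every graph in P(n, m) has at least n - m tree components,
   hence linearly many tree components of bounded size.  Joining two of them by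
   a new edge (a "bridge") keeps the graph planar, and this can be done in at
   least n^2 / Q ways.  Replacing an edge by a bridge shows that the number of
   graphs containing a given set of k edges is at most (Q / n)^k |P(n, m)|.  So
   the mean number of copies of H is bounded, and if e0 is an edge of H on its
   cycle, the mean number of copies of H - e0 is O(n).  By Markov's inequality
   at least half of the graphs have boundedly many copies of H and O(n) copies
   of H - e0.  In such a graph, replace the edge e0 of a copy of H by a bridge:
   this destroys a copy of H, and creates none because a bridge lies in a tree
   component.  The old graph is recovered from the new one by choosing the bridge
   (m ways) and the copy of H - e0 to be completed (O(n) ways), while there are
   n^2 / Q choices of bridges.  After boundedly many such steps no copy is left,
   so that a positive proportion of the graphs has no copy of H. *)

Set Implicit Arguments.
Unset Strict Implicit.
Unset Printing Implicit Defensive.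

(** * Tree components *)

Section Trees.
Variable W : finType.
Implicit Types (x y : W) (e U X : {set W}) (E F G : {set {set W}}).

Inductive tree : {set W} -> {set {set W}} -> Prop :=
| tree_single x : tree [set x] set0
| tree_join U1 U2 F1 F2 x y of tree U1 F1 & tree U2 F2 & [disjoint U1 & U2]
    & x \in U1 & y \in U2 : tree (U1 :|: U2) ([set x; y] |: (F1 :|: F2)).

Definition edges_at E U := [set e in E | ~~ [disjoint e & U]].

(** [edges_at] keeps every edge that meets [U], while the edges of a tree on [U] lie inside [U]. So
    no edge of [E] leaves [U]. *)
Definition tree_component E U := tree U (edges_at E U).

Lemma tree_sub U F e : tree U F -> e \in F -> e \subset U.
Proof.
move=> tUF; elim: tUF e => [x e|U1 U2 F1 F2 x y _ IH1 _ IH2 _ xU yU e].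
  by rewrite inE.
rewrite !inE => /or3P[/eqP->|/IH1 h|/IH2 h].
- by apply/subsetP => z; rewrite !inE => /orP[]/eqP->; rewrite ?xU ?yU ?orbT.
- exact: subset_trans h (subsetUl _ _).
- exact: subset_trans h (subsetUr _ _).
Qed.

Lemma tree_nonempty U F : tree U F -> U != set0.
Proof.
elim=> [x|U1 U2 F1 F2 x y _ _ _ _ _ xU _]; apply/set0Pn; exists x.
  by rewrite inE.
by rewrite inE xU.
Qed.

(** A forest has fewer edges than vertices, unless it is empty. In the induction the joining edge
    counts only if both its ends are in [X]; then both parts meet [X], and the spare unit of one of
    them pays for it. *)
Lemma tree_sparse U F X : tree U F ->
  #|[set e in F | e \subset X]| + (X :&: U != set0) <= #|X :&: U|.
Proof.
elim=> [x|U1 U2 F1 F2 x y _ IH1 _ IH2 dU xU yU].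
  rewrite (_ : [set _ in _ | _] = set0) ?cards0; last first.
    by apply/setP=> e; rewrite !inE.
  by rewrite -card_gt0; case: #|_|.
have -> : #|X :&: (U1 :|: U2)| = #|X :&: U1| + #|X :&: U2|.
  rewrite setIUr cardsU; apply/eqP; rewrite -[X in _ == X]subn0; apply/eqP.
  congr (_ - _); apply/eqP; rewrite cards_eq0 -subset0.
  move: dU; rewrite -setI_eq0 => /eqP <-.
  by apply/subsetP => z; rewrite !inE => /andP[/andP[_ ->] /andP[_ ->]].
set f1 := [set e in F1 | _] in IH1; set f2 := [set e in F2 | _] in IH2.
set f := [set e in _ | _].
have hb : (X :&: (U1 :|: U2) != set0) =
    (X :&: U1 != set0) || (X :&: U2 != set0).
  by rewrite setIUr setU_eq0 negb_and.
have [/subsetP sX|nsX] := boolP ([set x; y] \subset X).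
  have b1 : X :&: U1 != set0.
    by apply/set0Pn; exists x; rewrite inE xU sX // !inE eqxx.
  have b2 : X :&: U2 != set0.
    by apply/set0Pn; exists y; rewrite inE yU sX // !inE eqxx orbT.
  have : #|f| <= 1 + (#|f1| + #|f2|).
    rewrite -(cards1 [set x; y]).
    apply: (@leq_trans (#|[set [set x; y]] :|: (f1 :|: f2)|)).
      apply/subset_leq_card/subsetP => e; rewrite !inE => /andP[].
      by move=> /or3P[->|->|->] -> //; rewrite ?orbT.
    rewrite (leq_trans (leq_card_setU _ _).1) ?leq_add2l //.
    exact: (leq_card_setU _ _).1.
  by move: IH1 IH2; rewrite hb b1 b2 /=; lia.
have : #|f| <= #|f1| + #|f2|.
  apply: leq_trans (leq_card_setU _ _).1.
  apply/subset_leq_card/subsetP => e; rewrite !inE => /andP[].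
  case/or3P => [/eqP-> h|->|->] //; first by rewrite h in nsX.
    by move=> ->.
  by move=> ->; rewrite orbT.
by move: IH1 IH2; rewrite hb;
  case: (X :&: U1 != _); case: (X :&: U2 != _) => /=; lia.
Qed.

Lemma simple_graphS E F : E \subset F -> simple_graph F -> simple_graph E.
Proof.
move=> /subsetP EF /forallP sF; apply/forallP => e; apply/implyP => /EF eF.
exact: (implyP (sF e)).
Qed.

Lemma edges_at_setU1 E U e : [disjoint e & U] ->
  edges_at (e |: E) U = edges_at E U.
Proof.
move=> de; apply/setP => g; rewrite !inE.
by have [->|] := eqVneq g e; rewrite ?de ?andbF.
Qed.

Lemma edges_at_join E U1 U2 x y : x \in U1 -> y \in U2 ->
  edges_at ([set x; y] |: E) (U1 :|: U2) =
  [set x; y] |: (edges_at E U1 :|: edges_at E U2).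
Proof.
move=> xU yU; apply/setP => g; rewrite !inE.
have -> : [disjoint g & U1 :|: U2] = [disjoint g & U1] && [disjoint g & U2].
  by rewrite -!setI_eq0 setIUr setU_eq0.
have [->|_] /= := eqVneq g; last by rewrite -andb_orr negb_and.
suff h : ~~ [disjoint [set x; y] & U1] by rewrite negb_and h.
by apply/pred0Pn; exists x; rewrite /= !inE eqxx xU.
Qed.

Lemma tree_component_join E U1 U2 x y :
  tree_component E U1 -> tree_component E U2 -> [disjoint U1 & U2] ->
  x \in U1 -> y \in U2 -> tree_component ([set x; y] |: E) (U1 :|: U2).
Proof.
by move=> t1 t2 d xU yU; rewrite /tree_component edges_at_join //; apply: tree_join.
Qed.

(** Induction on the number of edges: putting an edge back costs at most one member of [P], since it
    joins two of the trees or spoils at most one. *)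
Lemma many_tree_components E : simple_graph E ->
  exists P : {set {set W}}, [/\ trivIset P,
    forall U, U \in P -> tree_component E U & #|W| <= #|P| + #|E|].
Proof.
have [k] := ubnP #|E|; elim: k E => // k IH E cE sE.
have [->|/set0Pn[e eE]] := eqVneq E set0.
  exists [set [set x] | x in W]; split.
  - apply/trivIsetP => _ _ /imsetP[x _ ->] /imsetP[y _ ->].
    by rewrite disjoints1 inE eq_sym; apply: contraNneq => ->.
  - move=> _ /imsetP[x _ ->]; rewrite /tree_component.
    rewrite (_ : edges_at _ _ = set0); first exact: tree_single.
    by apply/setP => g; rewrite !inE.
  - by rewrite cards0 addn0 card_imset //; exact: set1_inj.
have [u [v [uv def_e]]] : exists u v, u != v /\ e = [set u; v].
  by apply/cards2P; move/forallP: sE => /(_ e); rewrite eE.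
have cE1 : #|E| = (#|E :\ e|).+1 by rewrite (cardsD1 e) eE.
have [||P [tP cP leP]] := IH (E :\ e); first by lia.
  exact: simple_graphS (subD1set _ _) sE.
have defE : E = e |: (E :\ e) by rewrite setD1K.
have keep U : U \in P -> [disjoint e & U] -> tree_component E U.
  by move=> UP dU; rewrite defE /tree_component edges_at_setU1 //; exact: cP.
(* The case where [e] meets at most one member of [P]: that member is discarded. The set [A] may
   itself lie outside [P]. *)
have drop (A : {set W}) : (forall U, U \in P -> U != A -> [disjoint e & U]) ->
    exists P : {set {set W}}, [/\ trivIset P,
      forall U, U \in P -> tree_component E U & #|W| <= #|P| + #|E|].
  move=> hA; exists (P :\ A); split.
  - exact: trivIsetS (subD1set _ _) tP.
  - by move=> U; rewrite !inE => /andP[nA UP]; apply: keep => //; apply: hA.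
  - apply: leq_trans leP _; rewrite cE1 (cardsD1 A P) addnS -addSn leq_add2r.
    by case: (A \in P).
have meet U : ~~ [disjoint e & U] -> u \in U \/ v \in U.
  rewrite def_e => /pred0Pn[z /=]; rewrite !inE => /andP[/orP[]/eqP->]; by [left|right].
have disj U U' z : U \in P -> U' \in P -> z \in U -> z \in U' -> U = U'.
  move=> UP UP' zU zU'; rewrite -(def_pblock tP UP zU).
  by rewrite -(def_pblock tP UP' zU').
have [/bigcupP[U1 U1P uU]|nu] := boolP (u \in cover P); last first.
  apply: (drop (pblock P v)) => U UP; apply: contraNT => /meet[uU|vU].
    by case/negP: nu; apply/bigcupP; exists U.
  by rewrite (def_pblock tP UP vU).
have [/bigcupP[U2 U2P vU]|nv] := boolP (v \in cover P); last first.
  apply: (drop U1) => U UP; apply: contraNT => /meet[uU'|vU'].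
    by rewrite (disj _ _ _ UP U1P uU' uU).
  by case/negP: nv; apply/bigcupP; exists U.
(* Here [e] closes a cycle in the tree [U1], which is dropped. *)
have [eqU|neU] := eqVneq U1 U2.
  apply: (drop U1) => U UP; apply: contraNT => /meet[uU'|vU'].
    by rewrite (disj _ _ _ UP U1P uU' uU).
  by rewrite eqU (disj _ _ _ UP U2P vU' vU).
have d12 : [disjoint U1 & U2] by move/trivIsetP: tP; apply.
have dU U : U \in P -> U != U1 -> U != U2 -> [disjoint U1 :|: U2 & U].
  move=> UP n1 n2; rewrite -setI_eq0 setIUl setU_eq0 !setI_eq0.
  by apply/andP; split; move/trivIsetP: tP; apply; rewrite // eq_sym.
have nP : U1 :|: U2 \notin P :\ U1 :\ U2.
  rewrite !inE; apply/and3P => -[n2 n1 UP].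
  have := dU _ UP n1 n2; rewrite -setI_eq0 setIid.
  by rewrite setU_eq0 (negPf (tree_nonempty (cP _ U1P))).
exists ((U1 :|: U2) |: (P :\ U1 :\ U2)); split.
- apply/trivIsetP => A B; rewrite !inE.
  move=> /orP[/eqP->|/and3P[a2 a1 aP]] /orP[/eqP->|/and3P[b2 b1 bP]].
  + by rewrite eqxx.
  + by move=> _; apply: dU.
  + by move=> _; rewrite disjoint_sym; apply: dU.
  + by move/trivIsetP: tP; apply.
- move=> U; rewrite !inE => /orP[/eqP->|/and3P[a2 a1 aP]].
    rewrite defE {1}def_e; apply: tree_component_join => //; exact: cP.
  apply: keep => //; apply: contraT => /meet[uU'|vU'].
    by rewrite (disj _ _ _ aP U1P uU' uU) eqxx in a1.
  by rewrite (disj _ _ _ aP U2P vU' vU) eqxx in a2.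
- rewrite cardsU1 nP; move: leP; rewrite cE1 (cardsD1 U1 P) U1P.
  rewrite (cardsD1 U2 (P :\ U1)) !inE eq_sym neU U2P /=.
  by rewrite !add1n !addSn addnS.
Qed.

End Trees.

(** * New edges between small tree components *)

Lemma leq_sqr_bin2 n : 2 <= n -> n ^ 2 <= 4 * 'C(n, 2).
Proof.
case: n => // n n1; have := bin_ffact n.+1 2; rewrite !ffactnS ffactn0 muln1 /=.
by rewrite (_ : 2`! = 2) //; move: 'C(_, _) => c; nia.
Qed.

Section Bridges.
Variable W : finType.
Implicit Types (x y : W) (U b : {set W}) (G : {set {set W}}).

(** A bridge is not yet an edge of [G]: it is a cut edge of the graph obtained by adding it. The
    size bound [S] limits the copies that it can create. *)
Definition bridge S G b := exists U1 U2 x y,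
  [/\ tree_component G U1 /\ #|U1| <= S, tree_component G U2 /\ #|U2| <= S,
      [disjoint U1 & U2], x \in U1 /\ y \in U2 & b = [set x; y]].

Lemma bridge_notin S G b : bridge S G b -> b \notin G.
Proof.
move=> [U1 [U2 [x [y [[t1 _] _ d [xU yU] ->]]]]]; apply/negP => bG.
have /(tree_sub t1)/subsetP/(_ y) : [set x; y] \in edges_at G U1.
  by rewrite inE bG; apply/pred0Pn; exists x; rewrite /= !inE eqxx xU.
rewrite !inE eqxx orbT => /(_ isT) yU1.
by move/pred0P: d => /(_ y) /=; rewrite yU1 yU.
Qed.

Lemma bridge_tree_component S G b : bridge S G b ->
  exists U, [/\ #|U| <= S + S, b \subset U & tree_component (b |: G) U].
Proof.
move=> [U1 [U2 [x [y [[t1 s1] [t2 s2] d [xU yU] ->]]]]]; exists (U1 :|: U2); split.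
- by rewrite (leq_trans (leq_card_setU _ _).1) // leq_add.
- by apply/subsetP => z; rewrite !inE => /orP[]/eqP->; rewrite ?xU ?yU ?orbT.
- exact: tree_component_join.
Qed.

(** At least [#|W| / q] tree components exist, and at most half that number can have more than
    [2 * q] vertices. With one representative for each small one, every pair of representatives is a
    bridge. *)
Lemma many_bridges G q : simple_graph G -> #|W| <= q * (#|W| - #|G|) ->
  4 * q <= #|W| -> exists B : {set {set W}},
  (forall b, b \in B -> bridge (2 * q) G b) /\ #|W| ^ 2 <= 16 * q ^ 2 * #|B|.
Proof.
move=> sG leq_q le4q.
have [P [tP cP leP]] := many_tree_components sG.
pose Q := [set U in P | #|U| <= 2 * q].
have QP : Q \subset P by apply/subsetP => U; rewrite inE => /andP[].
have tQ : trivIset Q by exact: trivIsetS tP.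
have pQ : partition Q (cover Q).
  rewrite /partition eqxx tQ /=; apply/negP => /(subsetP QP)/cP/tree_nonempty.
  by rewrite eqxx.
have trQ := transversalP pQ; set Z := transversal _ _ in trQ.
have cZ : #|Z| = #|Q| := card_transversal trQ.
have leZ : #|W| <= 2 * q * #|Z|.
  have big : 2 * q * #|P :\: Q| <= #|W|.
    apply: leq_trans (max_card (cover P)).
    rewrite -(eqP (_ : trivIset P)) // (big_setID Q) /=.
    apply: leq_trans (leq_addl _ _).
    rewrite mulnC -sum_nat_const; apply: leq_sum => U.
    by rewrite !inE => /andP[+ UP]; rewrite UP /= -ltnNge => /ltnW.
  have cPQ : #|P| = #|Q| + #|P :\: Q|.
    by rewrite -(cardsID Q P) (setIidPr QP).
  rewrite cZ; move: leP leq_q big; rewrite cPQ.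
  set n := #|W|; set a := #|Q|; set c := #|_ :\: _|; set m := #|G|; nia.
exists [set b : {set W} | b \subset Z & #|b| == 2]; split.
  move=> b; rewrite inE => /andP[/subsetP bZ /cards2P[x [y [xy def_b]]]].
  have xZ : x \in Z by apply: bZ; rewrite def_b !inE eqxx.
  have yZ : y \in Z by apply: bZ; rewrite def_b !inE eqxx orbT.
  have /subsetP ZQ := transversal_sub trQ.
  have blk z : z \in Z -> [/\ pblock Q z \in Q, z \in pblock Q z,
      tree_component G (pblock Q z) & #|pblock Q z| <= 2 * q].
    move=> zZ; have zQ : pblock Q z \in Q by rewrite pblock_mem // ZQ.
    split=> //; first by rewrite mem_pblock ZQ.
      by apply: cP; apply: (subsetP QP).
    by move: zQ; rewrite inE => /andP[].
  have [xQ xx tx sx] := blk _ xZ; have [yQ yy ty sy] := blk _ yZ.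
  exists (pblock Q x), (pblock Q y), x, y; split=> //.
  move/trivIsetP: tQ; apply => //; apply: contra_neq xy.
  exact: (pblock_inj trQ).
rewrite cards_draws.
have [q0|q0] := posnP q; first by move: leq_q; rewrite q0; case: #|W|.
(* This is where [4 * q <= #|W|] enters: there must be a pair to choose. *)
have z2 : 2 <= #|Z| by rewrite -(leq_pmul2l (_ : 0 < 2 * q)) ?muln_gt0 //; lia.
apply: (@leq_trans ((2 * q * #|Z|) ^ 2)); first by rewrite leq_sqr.
have := leq_sqr_bin2 z2; rewrite !expnMn.
by move: 'C(_, _) (#|Z| ^ 2) (q ^ 2) => c d r; nia.
Qed.

End Bridges.

(** * Copies *)

Section Copies.
Variables V W : finType.
Implicit Types (H : {set {set V}}) (E G : {set {set W}}) (U b : {set W})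
  (f : {ffun V -> W}).

Lemma adjacent_sym (X : finType) (E : {set {set X}}) : symmetric (adjacent E).
Proof. by move=> x y; rewrite /adjacent setUC. Qed.

(** Embeddings are counted, so that a subgraph counts once per automorphism of [H]. *)
Definition copies H G : {set {ffun V -> W}} :=
  [set f : {ffun V -> W} | injectiveb f && [forall e in H, f @: e \in G]].

Lemma copiesP H G f : reflect (injective f /\ forall e, e \in H -> f @: e \in G)
  (f \in copies H G).
Proof.
rewrite inE; apply: (iffP andP) => [[/injectiveP i /forallP h]|[i h]].
  by split=> // e; apply/implyP.
by split; [apply/injectiveP|apply/forallP=> e; apply/implyP/h].
Qed.

Lemma has_copyE H G : has_copy H G = (copies H G != set0).
Proof.
apply/existsP/set0Pn => -[f hf]; exists f; first by rewrite inE.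
by rewrite inE in hf.
Qed.

Lemma copies_mono H E G : E \subset G -> copies H E \subset copies H G.
Proof.
move=> /subsetP EG; apply/subsetP => f /copiesP[i h]; apply/copiesP; split=> //.
by move=> e /h/EG.
Qed.

(** An edge of the copy that meets [U] lies inside [U], and connectedness of [H] carries this to all
    vertices. *)
Lemma copy_in_component H E U f v : connected_graph H -> tree_component E U ->
  f \in copies H E -> f v \in U -> forall w, f w \in U.
Proof.
move=> /andP[_ /forallP cH] tU /copiesP[_ h] fv w.
have clU x y : adjacent H x y -> f x \in U -> f y \in U.
  move=> /h fe fx.
  have /(tree_sub tU)/subsetP : f @: [set x; y] \in edges_at E U.
    rewrite inE fe; apply/pred0Pn; exists (f x).
    by rewrite /= fx imset_f // !inE eqxx.
  by apply; rewrite imset_f // !inE eqxx orbT.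
have cl : closed (adjacent H) [pred x | f x \in U].
  move=> x y xy; rewrite !inE; apply/idP/idP; apply: clU => //.
  by rewrite adjacent_sym.
have := closed_connect cl (forallP (cH v) w).
by rewrite !inE fv => <-.
Qed.

Lemma edge_nonempty (X : finType) (F : {set {set X}}) e :
  simple_graph F -> e \in F -> exists x, x \in e.
Proof.
move=> /forallP/(_ e) + eF; rewrite eF /= => /eqP ce.
by apply/card_gt0P; rewrite ce.
Qed.

(** The copy would lie wholly in the tree and have at least as many edges as vertices, against
    [tree_sparse]. *)
Lemma no_copy_in_component H E U f v : simple_graph H -> connected_graph H ->
  #|V| <= #|H| -> tree_component E U -> f \in copies H E -> f v \notin U.
Proof.
move=> sH cH leH tU fH; apply/negP => fv.
have fU := copy_in_component cH tU fH fv.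
have /copiesP[injf h] := fH.
have cV0 : 0 < #|V| by case/andP: cH.
have XU : f @: setT :&: U = f @: setT.
  by apply/setIidPl/subsetP => _ /imsetP[w _ ->].
have cX : #|f @: [set: V]| = #|V| by rewrite card_imset // cardsT.
have := tree_sparse (f @: [set: V]) tU; rewrite XU -card_gt0 cX cV0.
rewrite addn1 ltnNge => /negP; apply; apply: leq_trans leH _.
rewrite -(card_imset _ (imset_inj injf)); apply/subset_leq_card/subsetP.
move=> _ /imsetP[e eH ->]; rewrite !inE h //= imsetS ?subsetT // andbT.
have [z ze] := edge_nonempty sH eH.
by apply/pred0Pn; exists (f z); rewrite /= fU imset_f.
Qed.

Lemma copy_through_bridge H G b U f : simple_graph H -> b \subset U ->
  f \in copies H (b |: G) -> f \notin copies H G -> exists v, f v \in U.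
Proof.
move=> sH /subsetP bU /copiesP[injf h] nf.
have [/existsP[v fv]|nU] := boolP [exists v, f v \in U]; first by exists v.
case/negP: nf; apply/copiesP; split=> // e eH.
have := h e eH; rewrite !inE => /orP[/eqP fe|//].
have [z ze] := edge_nonempty sH eH.
by case/existsP: nU; exists z; apply: bU; rewrite -fe imset_f.
Qed.

Lemma copies_bridge_eq S H G b : simple_graph H -> connected_graph H ->
  #|V| <= #|H| -> bridge S G b -> copies H (b |: G) \subset copies H G.
Proof.
move=> sH cH leH /bridge_tree_component[U [_ bU tU]]; apply/subsetP => f fH.
apply: contraT => nf; have [v fv] := copy_through_bridge sH bU fH nf.
by case/negP: (no_copy_in_component v sH cH leH tU fH).
Qed.

(** A copy created by [b] lies in the tree component around [b], so it is one of the maps into a set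
    of at most [S + S] vertices. *)
Lemma card_copies_bridge S H G b : simple_graph H -> connected_graph H ->
  bridge S G b ->
  #|copies H (b |: G)| <= #|copies H G| + (S + S) ^ #|V|.
Proof.
move=> sH cH /bridge_tree_component[U [sU bU tU]].
apply: (@leq_trans #|copies H G :|: [set f in ffun_on (mem U)]|).
  apply/subset_leq_card/subsetP => f fH; rewrite in_setU orbC -implyNb.
  apply/implyP; apply: contraNT => nf; rewrite inE.
  have [v fv] := copy_through_bridge sH bU fH nf.
  by apply/ffun_onP => w; exact: (copy_in_component cH tU fH fv).
rewrite (leq_trans (leq_card_setU _ _).1) // leq_add2l cardsE card_ffun_on.
by case: #|V| => // k; rewrite leq_exp2r.
Qed.

(** * Spanning trees and an edge on the cycle *)

Lemma connect_mono (F F' : {set {set V}}) x y : F \subset F' ->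
  connect (adjacent F) x y -> connect (adjacent F') x y.
Proof.
move=> /subsetP FF'; apply: connect_sub => u v uv.
by apply: connect1; apply: FF'.
Qed.

Lemma spanning_tree H : connected_graph H ->
  exists2 F : {set {set V}}, F \subset H & connected_graph F /\ #|F| < #|V|.
Proof.
move=> cH; case/andP: (cH) => /card_gt0P[r _] /forallP conH.
(* The tree grows from the root [r]: each step adds an edge leaving [X], and with it one vertex. *)
have grow k : k < #|V| -> exists (X : {set V}) (F : {set {set V}}),
    [/\ #|X| = k.+1, F \subset H, #|F| <= k, r \in X & forall x : V, x \in X -> connect (adjacent F) r x].
  elim: k => [_|k IH lek].
    exists [set r], set0; rewrite cards1 cards0 sub0set !inE.
    by split=> // x; rewrite inE => /eqP->; exact: connect0.
  have [X [F [cX FH cF rX hX]]] := IH (ltnW lek).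
  have [z zX] : exists z, z \notin X.
    have : 0 < #|~: X| by rewrite cardsCs setCK subn_gt0 cX.
    by case/card_gt0P => z; rewrite inE; exists z.
  have [x [y [xX yX xy]]] : exists x y, [/\ x \in X, y \notin X & [set x; y] \in H].
    suff /existsP[x /andP[xX /existsP[y /andP[yX xy]]]] :
        [exists x, (x \in X) && [exists y, (y \notin X) && ([set x; y] \in H)]].
      by exists x, y.
    apply: contraT; rewrite negb_exists => /forallP nE.
    have cl x y : adjacent H x y -> x \in X -> y \in X.
      move=> xy xX; apply: contraT => yX; have := nE x; rewrite xX /=.
      by case/negP; apply/existsP; exists y; rewrite yX.
    have clX : closed (adjacent H) (mem X).
      move=> x y xy; apply/idP/idP; first exact: cl.
      by apply: cl; rewrite adjacent_sym.
    have := closed_connect clX (forallP (conH r) z).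
    by rewrite /= rX (negPf zX).
  exists (y |: X), ([set x; y] |: F); split.
  - by rewrite cardsU1 yX cX.
  - by rewrite subUset sub1set xy.
  - by rewrite (leq_trans (leq_card_setU _ _).1) // cards1 add1n.
  - by rewrite !inE rX orbT.
  - have FF' := subsetUr [set [set x; y]] F.
    move=> w; rewrite !inE => /orP[/eqP->|/hX]; last exact: connect_mono.
    apply: connect_trans (connect_mono FF' (hX _ xX)) _.
    by apply: connect1; rewrite /adjacent !inE eqxx.
have V0 : 0 < #|V| by apply/card_gt0P; exists r.
have [|X [F [cX FH cF rX hX]]] := grow #|V|.-1; first by rewrite prednK.
exists F => //; split; last by rewrite -(prednK V0) ltnS.
have XT x : x \in X.
  have /eqP -> : X == setT by rewrite eqEcard subsetT cardsT cX prednK /=.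
  by rewrite inE.
apply/andP; split=> //; apply/forallP => x; apply/forallP => y.
apply: connect_trans (hX y (XT y)).
by rewrite (sym_connect_sym (@adjacent_sym _ F)); apply: hX.
Qed.

(** [H] has more edges than a spanning tree; any edge outside the tree will do. This supplies the
    edge [e0] on the cycle. *)
Lemma connected_non_bridge H : connected_graph H -> #|V| <= #|H| ->
  exists2 e, e \in H & connected_graph (H :\ e).
Proof.
move=> cH leH; have [F FH [cF ltF]] := spanning_tree cH.
have [e eH eF] : exists2 e, e \in H & e \notin F.
  by apply/subsetPn; apply: contraL ltF => /subset_leq_card; lia.
exists e => //; case/andP: cF => V0 /forallP cF; apply/andP; split=> //.
apply/forallP => x; apply/forallP => y.
apply: connect_mono (forallP (cF x) y); apply/subsetP => g gF.
by rewrite !inE (subsetP FH) // andbT; apply: contraNneq eF => <-.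
Qed.

End Copies.

(** * Switching *)

Section Switching.
Variable W : finType.
Implicit Types (F G : {set {set W}}) (b : {set W}).
Let n := #|W|.
(** [P] stands for the class of planar graphs with [m] edges; of planarity, only the closure
    [P_switch] under switching is used here. *)
Variables (q m : nat) (P : {set {set {set W}}}) (B : {set {set W}} -> {set {set W}}).
Hypothesis P_edges : forall G, G \in P -> #|G| = m.
Hypothesis P_switch : forall G e b, G \in P -> e \in G -> bridge (2 * q) G b ->
  b |: (G :\ e) \in P.
Hypothesis B_bridge : forall G b, G \in P -> b \in B G -> bridge (2 * q) G b.
Hypothesis B_many : forall G, G \in P -> n ^ 2 <= 16 * q ^ 2 * #|B G|.
Hypothesis le_mn : m <= n.
Hypothesis n_gt0 : 0 < n.
Let Q := 16 * q ^ 2.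

(* Double counting of the triples (G, G', i): the edge that was removed from G
   is recovered from the label i, and the added one is among the m edges of
   G'. *)
Lemma switch_count (I : finType) (A A' : {set {set {set W}}})
    (rem : I -> {set W}) (lab : {set {set W}} -> I)
    (D : {set {set W}} -> {set I}) d :
  A \subset P -> A' \subset P ->
  (forall G, G \in A -> rem (lab G) \in G) ->
  (forall G b, G \in A -> b \in B G ->
    b |: (G :\ rem (lab G)) \in A' /\ lab G \in D (b |: (G :\ rem (lab G)))) ->
  (forall G, G \in A' -> #|D G| <= d) ->
  n * #|A| <= Q * d * #|A'|.
Proof.
move=> /subsetP AP /subsetP AP' hrem hsw hD.
rewrite -(leq_pmul2l n_gt0) mulnA.
pose S := [set p : {set {set W}} * {set W} | (p.1 \in A) && (p.2 \in B p.1)].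
have cS : n * n * #|A| <= Q * #|S|.
  have -> : #|S| = \sum_(G in A) #|B G|.
    under eq_bigr do rewrite -sum1_card.
    by rewrite pair_big_dep -sum1_card; apply: eq_bigl => p; rewrite inE.
  rewrite big_distrr /= mulnC -sum_nat_const; apply: leq_sum => G /AP GP.
  exact: B_many.
pose T := [set p : {set {set W}} * ({set W} * I) |
  [&& p.1 \in A', p.2.1 \in p.1 & p.2.2 \in D p.1]].
have cT : #|T| <= #|A'| * (m * d).
  have -> : #|T| = \sum_(G in A') #|setX G (D G)|.
    under eq_bigr do rewrite -sum1_card.
    rewrite pair_big_dep -sum1_card; apply: eq_bigl => p.
    by rewrite [LHS]inE [in RHS]inE.
  rewrite -sum_nat_const; apply: leq_sum => G GA'.
  by rewrite cardsX (P_edges (AP' _ GA')) leq_mul2l hD ?orbT.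
pose phi (p : {set {set W}} * {set W}) :=
  (p.2 |: (p.1 :\ rem (lab p.1)), (p.2, lab p.1)).
have phi_inj : {in S &, injective phi}.
  move=> [G b] [G' b']; rewrite !inE /= => /andP[GA bG] /andP[GA' bG'].
  case=> [eG eb el]; subst b'; congr pair.
  (* Undoing the switch deletes [b], which loses nothing because [b] was not an edge of [G0]. *)
  have rec G0 : G0 \in A -> b \in B G0 ->
      G0 = rem (lab G0) |: ((b |: (G0 :\ rem (lab G0))) :\ b).
    move=> GA0 bG0; rewrite setU1K ?setD1K ?hrem // !inE.
    by rewrite (negPf (bridge_notin (B_bridge (AP _ GA0) bG0))) andbF.
  by rewrite (rec _ GA bG) (rec _ GA' bG') eG el.
have leST : #|S| <= #|T|.
  rewrite -(card_in_imset phi_inj); apply/subset_leq_card/subsetP.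
  move=> _ /imsetP[[G b] + ->]; rewrite !inE /= => /andP[GA bG].
  by have [-> ->] := hsw _ _ GA bG; rewrite eqxx.
apply: leq_trans cS _; apply: leq_trans (leq_mul (leqnn Q) leST) _.
apply: leq_trans (leq_mul (leqnn Q) cT) _.
by rewrite mulnCA -!mulnA; nia.
Qed.

Definition supergraphs F := [set G in P | F \subset G].

(** Induction on [F]: switching a fixed edge [e] of [F] leads to a supergraph of [F :\ e]. As [e] is
    known, one label suffices, and each edge costs a factor [Q / n]. *)
Lemma card_supergraphs F : n ^ #|F| * #|supergraphs F| <= Q ^ #|F| * #|P|.
Proof.
have [k] := ubnP #|F|; elim: k F => // k IH F ltk.
have [->|/set0Pn[e eF]] := eqVneq F set0.
  rewrite cards0 !mul1n; apply/subset_leq_card/subsetP => G.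
  by rewrite inE => /andP[].
have cF : #|F| = (#|F :\ e|).+1 by rewrite (cardsD1 e) eF.
have IHF : n ^ #|F :\ e| * #|supergraphs (F :\ e)| <= Q ^ #|F :\ e| * #|P|.
  by apply: IH; move: ltk; rewrite cF.
have : n * #|supergraphs F| <= Q * 1 * #|supergraphs (F :\ e)|.
  have sP F' : supergraphs F' \subset P.
    by apply/subsetP => G; rewrite inE => /andP[].
  apply: (@switch_count _ _ _ id (fun=> e) (fun=> [set e])) => //.
  - by move=> G; rewrite inE => /andP[_ /subsetP]; apply.
  - move=> G b; rewrite !inE => /andP[GP FG] bG; rewrite eqxx; split=> //.
    rewrite P_switch //=; last exact: B_bridge.
      by rewrite subsetU // (setSD _ FG) orbT.
    exact: (subsetP FG).
  - by move=> G _; rewrite cards1.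
rewrite muln1 cF !expnS => h.
apply: (@leq_trans (n ^ #|F :\ e| * (Q * #|supergraphs (F :\ e)|))).
  by rewrite -mulnA mulnCA leq_mul2l h orbT.
by rewrite mulnCA -mulnA leq_mul2l IHF orbT.
Qed.

Variable V : finType.
Implicit Types H : {set {set V}}.

(** Linearity of expectation: at most [n ^ #|V|] injections, each an embedding with probability at
    most [(Q / n) ^ #|H|]. *)
Lemma sum_copies H :
  n ^ #|H| * \sum_(G in P) #|copies H G| <= Q ^ #|H| * #|P| * n ^ #|V|.
Proof.
have -> : \sum_(G in P) #|copies H G| =
    \sum_(f : {ffun V -> W} | injectiveb f) #|supergraphs ([set f @: e | e : {set V} in H])|.
  under eq_bigr do rewrite -sum1_card.
  under [RHS]eq_bigr do rewrite -sum1_card.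
  rewrite (exchange_big_dep (fun f : {ffun V -> W} => injectiveb f)) /=; last first.
    by move=> G f _ /copiesP[/injectiveP].
  apply: eq_bigr => f fi; apply: eq_bigl => G; rewrite !inE fi /=; congr andb.
  apply/forallP/subsetP => [h _ /imsetP[e eH ->]|h e]; first exact: (implyP (h e)).
  by apply/implyP => eH; apply: h; rewrite imset_f.
rewrite big_distrr /= mulnC.
apply: (@leq_trans (\sum_(f : {ffun V -> W} | injectiveb f) Q ^ #|H| * #|P|)).
  apply: leq_sum => f /injectiveP fi.
  have := card_supergraphs [set f @: e | e : {set V} in H].
  by rewrite card_imset //; apply: imset_inj.
rewrite sum_nat_const leq_mul2r; apply/orP; right.
by rewrite -card_ffun max_card.
Qed.

Definition few_copies H H' j K :=
  [set G in P | (#|copies H G| <= j) && (#|copies H' G| <= K * n)].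

Fixpoint switch_const (D j K : nat) : nat :=
  if j is j'.+1 then
    switch_const D j' K + Q * (K + D) * switch_const D j' (K + D)
  else 1.

Section OneEdge.
Variables (H : {set {set V}}) (e0 : {set V}).
Hypotheses (sH : simple_graph H) (cH : connected_graph H) (leH : #|V| <= #|H|)
  (e0H : e0 \in H) (cH' : connected_graph (H :\ e0)).
Let D := (2 * q + 2 * q) ^ #|V|.

(** In a graph with exactly [j.+1] copies, the edge [e0] of a chosen copy is switched. The label is
    that copy, which survives as a copy of [H :\ e0]; hence at most [(K + D) * n] labels, and the
    factor [n] cancels against the one gained by switching. *)
Lemma few_copies_step j K :
  #|few_copies H (H :\ e0) j.+1 K| <= #|few_copies H (H :\ e0) j K| +
    Q * (K + D) * #|few_copies H (H :\ e0) j (K + D)|.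
Proof.
set A' := few_copies H (H :\ e0) j (K + D).
pose A := [set G in few_copies H (H :\ e0) j.+1 K | #|copies H G| == j.+1].
apply: (@leq_trans (#|few_copies H (H :\ e0) j K| + #|A|)).
  apply: leq_trans (leq_card_setU _ _).1.
  apply/subset_leq_card/subsetP => G; rewrite !inE => /and3P[-> + ->] /=.
  by rewrite leq_eqVlt ltnS => /orP[/eqP->|->]; rewrite ?eqxx ?leqnn ?orbT.
rewrite leq_add2l -(leq_pmul2l n_gt0).
have [->|/set0Pn[G0 G0A]] := eqVneq A set0; first by rewrite cards0 muln0.
have [f0 _] : exists f0, f0 \in copies H G0.
  move: G0A; rewrite inE => /andP[_ /eqP c].
  by apply/card_gt0P; rewrite c.
(* The default [f0] is only taken outside [A]. *)
pose lab G := odflt f0 [pick f in copies H G].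
have labP G : G \in A -> lab G \in copies H G.
  rewrite inE /lab => /andP[_ /eqP c]; case: pickP => //= h.
  by move: c; rewrite (eq_card0 h).
have AP : A \subset P by apply/subsetP => G; rewrite !inE => /andP[/andP[]].
have -> : n * (Q * (K + D) * #|A'|) = Q * ((K + D) * n) * #|A'| by nia.
apply: (@switch_count _ _ _ (fun f : {ffun V -> W} => f @: e0) lab
  (copies (H :\ e0))) => //.
- by apply/subsetP => G; rewrite !inE => /andP[].
- by move=> G /labP/copiesP[_]; apply.
- move=> G b GA bB; set e := lab G @: e0.
  have GP := subsetP AP _ GA; have bb := B_bridge GP bB.
  have /copiesP[li lh] := labP _ GA.
  have subG : b |: (G :\ e) \subset b |: G by rewrite setUS // subD1set.
  have /copies_mono c1 := subG.
  split; last first.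
    apply/copiesP; split=> // g; rewrite !inE => /andP[ge gH].
    by rewrite lh // andbT (inj_eq (imset_inj li)) ge orbT.
  rewrite inE P_switch //=; last exact: lh.
  move: (GA); rewrite !inE => /andP[/and3P[_ _ cK] /eqP cj]; apply/andP; split.
    (* The bridge creates no copy of [H], and the chosen copy is gone because its edge [e] differs
       from [b]. *)
    rewrite -ltnS -cj; apply: proper_card; apply/properP; split.
      by apply: subset_trans (c1 _ H) _; apply: copies_bridge_eq bb.
    exists (lab G); first exact: labP.
    apply/negP => /copiesP[_ /(_ _ e0H)]; rewrite !inE eqxx /= orbF => /eqP eb.
    by case/negP: (bridge_notin bb); rewrite -eb lh.
  rewrite (leq_trans (subset_leq_card (c1 _ _))) //.
  have sH' : simple_graph (H :\ e0) by exact: simple_graphS (subD1set _ _) sH.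
  apply: leq_trans (card_copies_bridge sH' cH' bb) _.
  by rewrite mulnDl leq_add // -/D leq_pmulr.
- by move=> G; rewrite !inE => /and3P[].
Qed.

Lemma few_copies_le j K :
  #|few_copies H (H :\ e0) j K| <=
  switch_const D j K * #|[set G in P | copies H G == set0]|.
Proof.
elim: j K => [|j IH] K /=.
  rewrite mul1n; apply/subset_leq_card/subsetP => G; rewrite !inE => /and3P[->].
  by rewrite leqn0 cards_eq0.
apply: leq_trans (few_copies_step j K) _.
by rewrite mulnDl -[X in _ <= _ + X]mulnA leq_add // leq_mul.
Qed.

(** The thresholds are four times the bounds on the means, so by Markov's inequality each is
    exceeded by at most a quarter of [P]; half of [P] remains for [few_copies_le]. *)
Lemma card_copyfree : 0 < q -> #|H| = #|V| ->
  #|P| <= 2 * switch_const D (4 * Q ^ #|V|) (4 * Q ^ #|V|.-1) *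
    #|[set G in P | copies H G == set0]|.
Proof.
move=> q0 eH; set a := Q ^ #|V|; set a' := Q ^ #|V|.-1.
have Q0 : 0 < Q by rewrite muln_gt0 expn_gt0 q0.
have V0 : 0 < #|V| by case/andP: cH.
have s1 : \sum_(G in P) #|copies H G| <= a * #|P|.
  have := sum_copies H; rewrite eH [X in _ <= X]mulnC leq_pmul2l //.
  by rewrite expn_gt0 n_gt0.
have s2 : \sum_(G in P) #|copies (H :\ e0) G| <= a' * n * #|P|.
  have cH1 : #|H :\ e0| = #|V|.-1 by rewrite -eH (cardsD1 e0 H) e0H.
  have eV : n ^ #|V| = n * n ^ #|V|.-1 by rewrite -expnS prednK.
  have := sum_copies (H :\ e0); rewrite cH1 eV.
  rewrite (_ : _ * _ * (n * _) = n ^ #|V|.-1 * (a' * n * #|P|)); last by rewrite /a'; nia.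
  by rewrite leq_pmul2l // expn_gt0 n_gt0.
have markov (X : {set {set W}} -> nat) t :
    0 < t -> \sum_(G in P) X G <= t * #|P| ->
    4 * #|[set G in P | 4 * t < X G]| <= #|P|.
  move=> t0 hX; rewrite -(leq_pmul2l t0) mulnA; apply: leq_trans hX.
  rewrite (bigID (fun G => 4 * t < X G)) /=; apply: leq_trans (leq_addr _ _).
  rewrite mulnC -sum_nat_const big_mkcond [X in _ <= X]big_mkcond.
  apply: leq_sum => G _; rewrite inE; case: ifP => // /andP[_ /ltnW].
  by rewrite [t * 4]mulnC.
have m1 := markov (fun G => #|copies H G|) a _ s1.
have m2 := markov (fun G => #|copies (H :\ e0) G|) (a' * n) _ s2.
have a0 : 0 < a by rewrite expn_gt0 Q0.
have a0' : 0 < a' * n by rewrite muln_gt0 expn_gt0 Q0.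
have {}m1 := m1 a0; have {}m2 := m2 a0'.
have := few_copies_le (4 * a) (4 * a').
set M := few_copies _ _ _ _; set c := switch_const _ _ _.
set z := #|[set G in P | _ == _]|.
set b1 := [set _ in _ | _] in m1; set b2 := [set _ in _ | _] in m2.
have : #|P| <= #|b1| + #|b2| + #|M|.
  apply: (@leq_trans #|b1 :|: b2 :|: M|).
    apply/subset_leq_card/subsetP => G GP; rewrite !inE GP /= mulnA.
    by rewrite !ltnNge -negb_and orNb.
  rewrite (leq_trans (leq_card_setU _ _).1) // leq_add2r.
  exact: (leq_card_setU _ _).1.
move: m1 m2; move: #|P| #|b1| #|b2| #|M| c z => *; nia.
Qed.

End OneEdge.
End Switching.

(** * Planarity *)

From mathcomp Require Import all_order all_algebra ring lra.
From mathcomp Require Import all_classical all_reals all_analysis.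
Import Order.TTheory GRing.Theory Num.Theory.
Import numFieldNormedType.Exports.

Local Open Scope classical_set_scope.
Local Open Scope ring_scope.

Section Planarity.
Variables (R : realType) (V : finType).
Implicit Types (E F : {set {set V}}) (S U : {set V}) (x y z : V).
Implicit Types (p : V -> R * R) (c : {set V} -> R -> R * R).

Definition segment (u v : R * R) (t : R) : R * R :=
  (u.1 + t * (v.1 - u.1), u.2 + t * (v.2 - u.2)).

Definition straight_at E S p c := forall e, e \in E -> ~~ [disjoint e & S] ->
  exists a b, [/\ a != b, e = [set a; b]%SET &
    forall t, 0 <= t <= 1 -> c e t = segment (p a) (p b) t].

(* The curves at the vertices of S are straight, so that a short segment in a
   new direction meets none of them: nothing of the kind holds at a vertex
   where arbitrary arcs end. *)
Definition drawable E S := exists p c, plane_drawing E p c /\ straight_at E S p c.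

Lemma planarS E F : E \subset F -> planar R F -> planar R E.
Proof.
move=> /fintype.subsetP EF [p [c [ip hc hd]]]; exists p, c; split=> //.
  by move=> e /EF; exact: hc.
by move=> e e' /EF eF /EF; exact: hd.
Qed.

Lemma exists_gt_all (I : finType) (f : I -> R) : exists k, forall i, f i < k.
Proof.
exists (1 + \sum_i `|f i|) => i; rewrite (bigD1 i) //=.
apply: (@lt_le_trans _ _ (1 + `|f i|)).
  by rewrite (le_lt_trans (ler_norm _)) // ltrDr.
by rewrite lerD2l lerDl sumr_ge0.
Qed.

Lemma plane_hausdorff : hausdorff_space (R * R)%type.
Proof. exact: norm_hausdorff. Qed.

(** Slope [k], parametrized by horizontal displacement. *)
Definition ray (u : R * R) (k s : R) : R * R := (u.1 + s, u.2 + s * k).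

Lemma ray_continuous u k : continuous (ray u k).
Proof.
move=> s.
have c1 : (u.1 + t) @[t --> s] --> u.1 + s.
  by apply: cvgD; [exact: cvg_cst|exact: cvg_id].
have c2 : (u.2 + t * k) @[t --> s] --> u.2 + s * k.
  by apply: cvgD; [exact: cvg_cst|apply: cvgM; [exact: cvg_id|exact: cvg_cst]].
exact: cvg_pair c1 c2.
Qed.

Lemma ray_inj u k : injective (ray u k).
Proof. by move=> s t [/addrI]. Qed.

(** Edges at [y] are segments of a direction other than that of the ray. Every other edge is a
    compact arc missing [p y], hence misses a neighbourhood of it, and there are finitely many
    edges. *)
Lemma ray_avoids E S p c y k : plane_drawing E p c -> straight_at E S p c ->
  y \in S ->
  (forall z, z != y -> k * ((p z).1 - (p y).1) != (p z).2 - (p y).2) ->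
  exists2 r : R, 0 < r & forall e s t, e \in E -> 0 < s <= r -> 0 <= t <= 1 ->
    c e t <> ray (p y) k s.
Proof.
move=> [ip hc hd] st yS hk.
suff [r r0 hr] : exists2 r : R, 0 < r & forall e s t, e \in E -> y \notin e ->
    0 < s <= r -> 0 <= t <= 1 -> c e t <> ray (p y) k s.
  exists r => // e s t eE sr t01; have [ye|] := boolP (y \in e); last first.
    by move=> ?; exact: hr.
  have [|a [b [ab def_e hs]]] := st e eE; first by apply/pred0Pn; exists y; rewrite /= ye.
  rewrite hs // /segment /ray => -[h1 h2].
  have s0 : s != 0 by case/andP: sr => /gt_eqF ->.
  move: ye; rewrite def_e !inE => /orP[] /eqP eq_y; subst y.
    have ba : b != a by rewrite eq_sym.
    have /eqP := hk b ba; apply; apply: (mulfI s0).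
    have e1 : s = t * ((p b).1 - (p a).1) by lra.
    have e2 : s * k = t * ((p b).2 - (p a).2) by lra.
    by rewrite mulrA e2 e1; ring.
  have /eqP := hk a ab; apply; apply: (mulfI s0).
  have e1 : s = (1 - t) * ((p a).1 - (p b).1) by lra.
  have e2 : s * k = (1 - t) * ((p a).2 - (p b).2) by lra.
  by rewrite mulrA e2 e1; ring.
have near0 (e : {set V}) : \forall s \near (0 : R), e \in E -> y \notin e ->
    ~ (c e @` `[0, 1]) (ray (p y) k s).
  have [eE|] := boolP (e \in E); last by move=> _; near=> s.
  have [ye|ye] := boolP (y \in e); first by near=> s.
  have [ce _ he hi] := hc e eE.
  have clK : closed (c e @` `[0, 1]).
    apply: (compact_closed plane_hausdorff).
    by apply: continuous_compact => //; exact: segment_compact.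
  have nK : ~ (c e @` `[0, 1]) (ray (p y) k 0).
    have -> : ray (p y) k 0 = p y by rewrite /ray mul0r !addr0 -surjective_pairing.
    move=> [t /= t01 ct].
    have end_ne u : [set c e 0; c e 1] u -> u <> p y.
      by rewrite he => -[z /= ze <-] /ip zy; rewrite -zy ze in ye.
    have [t0|t0] := eqVneq t 0; first by apply: (end_ne (c e t)); rewrite // t0; left.
    have [t1|t1] := eqVneq t 1; first by apply: (end_ne (c e t)); rewrite // t1; right.
    suff : (c e @` `]0, 1[ `&` range p) (p y) by rewrite hi.
    split; last by exists y.
    exists t => //=; move: t01; rewrite !in_itv /= => /andP[a b].
    by rewrite !lt_neqAle a b t1 eq_sym t0.
  have : \forall s \near (0:R), (~` (c e @` `[0, 1])) (ray (p y) k s).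
    apply: (@ray_continuous (p y) k 0); apply: open_nbhs_nbhs; split=> //.
    exact: closed_openC.
  by apply: filterS => s hs _ _; exact: hs.
have := @filter_forall _ _ (fun (e : {set V}) s => e \in E -> y \notin e ->
  ~ (c e @` `[0, 1]) (ray (p y) k s)) (nbhs (0 : R)) _ near0.
(* Halving the radius of the open ball allows the closed bound on [s]. *)
move=> /(_ (nbhs_filter _))/nbhs_ballP[r /= r0 hr]; exists (r / 2); first by rewrite divr_gt0.
move=> e s t eE ye /andP[s0 sr] t01 ct.
apply: (hr s _ e eE ye); last by exists t.
rewrite /ball /= sub0r normrN gtr0_norm //; lra.
Unshelve. all: by end_near.
Qed.

(** No edge ends at [x], so it can be moved next to [y], along a short ray that avoids the
    drawing. *)
Lemma drawable_leaf E S x y : drawable E S -> x != y -> y \in S ->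
  (forall e, e \in E -> x \notin e) -> drawable ([set x; y]%SET |: E) S.
Proof.
move=> [p [c [pd st]]] xy yS hx.
have [k hk] : exists k, forall z, z != y ->
    k * ((p z).1 - (p y).1) != (p z).2 - (p y).2.
  (* The slope is larger than all slopes from [p y] to other vertices. For a vertex straight above
     or below [p y], equality would force the two points to coincide. *)
  have [k hk] := exists_gt_all (fun z => ((p z).2 - (p y).2) / ((p z).1 - (p y).1)).
  exists k => z zy; apply/eqP => h.
  have [d0|d0] := eqVneq ((p z).1 - (p y).1) 0.
    case: pd => ip _ _; case/eqP: zy; apply: ip.
    move/eqP: d0; move/eqP: h; rewrite (eq_sym (_ * _)) => h d0.
    move: h; rewrite (eqP d0) mulr0 subr_eq0; move: d0; rewrite subr_eq0.
    by case: (p z) (p y) => u v [u' v'] /= /eqP-> /eqP->.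
  by have := hk z; rewrite -h mulfK // ltxx.
(* The new position of x is [ray (p y) k r]. *)
have [r r0 hr] := ray_avoids pd st yS hk.
have rayz s z : z != y -> ray (p y) k s <> p z.
  move=> /hk/eqP zy h; apply: zy; rewrite -h /ray /=; ring.
have ray0 : ray (p y) k 0 = p y by rewrite /ray mul0r !addr0 -surjective_pairing.
have rnz : r != 0 by rewrite gt_eqF.
case: (pd) => ip hc hd.
pose p' z := if z == x then ray (p y) k r else p z.
pose c' e t := if e == [set x; y]%SET then ray (p y) k (r * t) else c e t.
have p'y : p' y = p y by rewrite /p' eq_sym (negPf xy).
have p'x : p' x = ray (p y) k r by rewrite /p' eqxx.
have p'E e z : e \in E -> z \in e -> p' z = p z.
  by move=> /hx xe ze; rewrite /p'; case: eqP ze xe => // -> ->.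
have e0E : [set x; y]%SET \notin E.
  by apply/negP => /hx; rewrite !inE eqxx.
have c'E e : e \in E -> c' e = c e.
  by rewrite /c' => eE; case: eqP eE e0E => // -> ->.
have c'0 t : c' [set x; y]%SET t = ray (p y) k (r * t) by rewrite /c' eqxx.
have rt t : 0 < t < 1 -> 0 < r * t <= r.
  by move=> /andP[t0 t1]; rewrite mulr_gt0 //= ger_pMr // ltW.
have new_old e t s : e \in E -> 0 < t < 1 -> 0 <= s <= 1 ->
    c e s <> c' [set x; y]%SET t.
  by move=> eE t01 s01; rewrite c'0; apply: hr => //; exact: rt.
have int01 (t : R) : 0 < t < 1 -> 0 <= t <= 1 by move=> /andP[/ltW -> /ltW ->].
exists p', c'; split; first split.
- move=> z z'; rewrite /p'; case: eqP => [->|_]; case: eqP => [->|_] //.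
  + have [->|zy h] := eqVneq z' y; last by case: (rayz _ _ zy h).
    by rewrite -{2}ray0 => /ray_inj/eqP; rewrite (negPf rnz).
  + have [->|zy h] := eqVneq z y; last by case: (rayz _ _ zy (esym h)).
    by rewrite -{1}ray0 => /ray_inj/esym/eqP; rewrite (negPf rnz).
  + exact: ip.
- move=> e; rewrite !inE => /orP[/eqP->|eE].
    have cE : c' [set x; y]%SET = fun t => ray (p y) k (r * t) by apply/funext.
    split.
    + rewrite cE; apply: continuous_subspaceT => t.
      apply: (@continuous_comp _ _ _ (fun t => r * t)); last exact: ray_continuous.
      exact: mulrl_continuous.
    + by move=> s t _ _; rewrite !c'0 => /ray_inj/(mulfI rnz).
    + rewrite !c'0 mulr0 mulr1 ray0; apply/seteqP; split=> [u [->|->]|u [z /=]].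
      * by exists y; rewrite //= !inE eqxx orbT.
      * by exists x; rewrite //= !inE eqxx.
      * by rewrite !inE => /orP[]/eqP-> <-; [right|left].
    + apply/seteqP; split=> // u [[t /=]]; rewrite in_itv /= => t01 <- [z _].
      rewrite c'0 /p'; case: eqP => [_ /ray_inj|_].
        rewrite -{1}(mulr1 r) => /(mulfI rnz) t1.
        by move: t01; rewrite -t1 ltxx andbF.
      have [->|zy h] := eqVneq z y; last by case: (rayz _ _ zy (esym h)).
      rewrite -{1}ray0 => /ray_inj/esym/eqP.
      by rewrite mulf_eq0 (negPf rnz) /= => /eqP t0; rewrite t0 ltxx in t01.
  have [ce ie he hi] := hc e eE; rewrite c'E //; split=> //.
  + rewrite he; apply/seteqP; split=> u [z /= ze <-]; exists z => //=.
      exact: p'E ze.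
    by rewrite (p'E e).
  + apply/seteqP; split=> // u [[t /= t01 <-] [z _]].
    rewrite /p'; case: eqP => [_|_ h].
      move: t01; rewrite in_itv /= => t01 /esym; apply: hr => //.
        by rewrite r0 lexx.
      exact: int01.
    suff : (c e @` `]0, 1[ `&` range p) (p z) by rewrite hi.
    by split; [exists t|exists z].
- move=> e e'; rewrite !inE => /orP[/eqP->|eE] /orP[/eqP->|e'E].
  + by rewrite eqxx.
  + move=> _; apply/seteqP; split=> // u [[t /=]]; rewrite in_itv /= => t01 <-.
    by move=> [s /=]; rewrite in_itv /= c'E // => /int01 s01; apply: new_old.
  + move=> _; apply/seteqP; split=> // u [[t /=]]; rewrite in_itv /= c'E // => t01 <-.
    move=> [s /=]; rewrite in_itv /= => s01 /esym; apply: new_old => //.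
    exact: int01.
  + by rewrite !c'E //; apply: hd.
move=> e; rewrite !inE => /orP[/eqP-> _|eE].
  exists y, x; split; [by rewrite eq_sym|by rewrite finset.setUC|].
  move=> t t01; rewrite c'0 p'y p'x /segment /ray /=; congr pair; ring.
move=> /(st e eE)[a [b [ab def_e hs]]]; exists a, b; split=> // t t01.
by rewrite c'E // (p'E e) // ?(p'E e) // ?hs // def_e !inE eqxx ?orbT.
Qed.

(* The induction splits the tree at the edge x1 x2: the part of y is drawn
   first, then the leaf edge to the other part, which is drawn from there. *)
Lemma drawable_tree U F E S y : tree U F -> y \in U ->
  U \subset S -> (forall z e, z \in U -> z != y -> e \in E -> z \notin e) ->
  drawable E S -> drawable (F :|: E) S.
Proof.
move=> tUF; elim: tUF y E => [x y E|U1 U2 F1 F2 x1 x2 t1 IH1 t2 IH2 d xU1 xU2 y E].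
  by rewrite finset.set0U.
wlog yU1 : U1 U2 F1 F2 x1 x2 t1 t2 IH1 IH2 d xU1 xU2 / y \in U1.
  move=> wl; rewrite inE => /orP[yU1|yU2]; first by apply: wl => //; rewrite inE yU1.
  rewrite finset.setUC (_ : [set x1; x2]%SET = [set x2; x1]%SET); last exact: finset.setUC.
  rewrite (finset.setUC F1); apply: wl => //; first by rewrite disjoint_sym.
  by rewrite inE yU2.
move=> _ US hz dr.
have U1S : U1 \subset S by apply: fintype.subset_trans US; exact: finset.subsetUl.
have U2S : U2 \subset S by apply: fintype.subset_trans US; exact: finset.subsetUr.
have disj z : z \in U1 -> z \in U2 -> False.
  by move=> z1 z2; move/pred0P: d => /(_ z) /=; rewrite z1 z2.
have z2y z : z \in U2 -> z != y.
  by move=> z2; apply/eqP => zy; apply: (disj z); rewrite // zy.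
have dr1 : drawable (F1 :|: E) S.
  by apply: (IH1 y) => // z e z1; apply: hz; rewrite inE z1.
have iso z e : z \in U2 -> e \in F1 :|: E -> z \notin e.
  move=> z2; rewrite inE => /orP[eF|eE].
    apply/negP => ze; apply: (disj z) => //.
    exact: (fintype.subsetP (tree_sub t1 eF)).
  by apply: (hz z e) => //; [rewrite inE z2 orbT|exact: z2y].
have dr2 : drawable ([set x1; x2]%SET |: (F1 :|: E)) S.
  rewrite (_ : [set x1; x2]%SET = [set x2; x1]%SET); last exact: finset.setUC.
  apply: drawable_leaf => //.
  - by apply/eqP => x21; apply: (disj x1); rewrite // -x21.
  - exact: (fintype.subsetP U1S).
  - by move=> e; apply: iso.
rewrite (_ : _ :|: E = F2 :|: ([set x1; x2]%SET |: (F1 :|: E))); last first.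
  by apply/setP => e; rewrite !inE; do 4 case: (_ \in _) || case: (_ == _).
apply: (IH2 x2) => // z e z2 zx; rewrite in_setU1 => /orP[/eqP->|]; last exact: iso.
rewrite !inE negb_or zx andbT; apply/eqP => zx1; apply: (disj z) => //.
by rewrite zx1.
Qed.

(* The two tree components are erased and drawn anew, joined, starting from
   one of their vertices. *)
Lemma planar_bridge k E b : planar R E -> bridge k E b -> planar R (b |: E)%SET.
Proof.
move=> plE [U1 [U2 [x [y [[t1 _] [t2 _] d [xU1 yU2] ->]]]]].
have tU := tree_component_join t1 t2 d xU1 yU2.
set U := (U1 :|: U2)%SET in tU; set E' := ([set x; y]%SET |: E) in tU *.
have xU : x \in U by rewrite inE xU1.
pose E0 := [set e in E' | [disjoint e & U]]%SET.
have -> : E' = (edges_at E' U :|: E0)%SET.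
  apply/setP => e; rewrite !inE.
  by case: [disjoint e & U]%B; rewrite ?andbT ?andbF ?orbF.
have E0E : E0 \subset E.
  apply/fintype.subsetP => e; rewrite !inE => /andP[/orP[/eqP->|//]].
  by move=> /pred0P /(_ x) /=; rewrite xU !inE eqxx.
have [p [c pd]] := planarS E0E plE.
suff [p' [c' [pd' _]]] : drawable (edges_at E' U :|: E0) U by exists p', c'.
have E0U z e : z \in U -> e \in E0 -> z \notin e.
  move=> zU; rewrite inE => /andP[_ /pred0P/(_ z)] /=.
  by rewrite zU andbT => ->.
apply: (drawable_tree tU xU) => //; first by move=> z e zU _; exact: E0U.
(* Straightness is vacuous: no edge of [E0] meets [U]. *)
by exists p, c; split=> // e; rewrite inE => /andP[_ ->].
Qed.

End Planarity.

(** * The limit superior *)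

Lemma bridge_card2 (W : finType) k (G : {set {set W}}) b :
  bridge k G b -> #|b| = 2%N.
Proof.
move=> [U1 [U2 [x [y [_ _ d [xU yU] ->]]]]]; rewrite cards2.
by case: eqP xU => [->|//] yU1; move/pred0P: d => /(_ y) /=; rewrite yU1 yU.
Qed.

Lemma planar_switch (R : realType) n m k (G : {set {set 'I_n}}) e b :
  G \in planar_graphs R n m -> e \in G -> bridge k G b ->
  (b |: (G :\ e))%SET \in planar_graphs R n m.
Proof.
rewrite !inE => /and3P[sG /eqP cG /asboolP pG] eG bG; apply/and3P; split.
- apply/forallP => g; apply/implyP; rewrite !inE => /orP[/eqP->|/andP[_ gG]].
    by rewrite (bridge_card2 bG).
  exact: (implyP (forallP sG g)).
- by rewrite cardsU1 !inE (negPf (bridge_notin bG)) andbF -cG (cardsD1 e G) eG.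
- apply/asboolP; apply: planarS (planar_bridge pG bG).
  by rewrite finset.setUS // subD1set.
Qed.

(** The point is that one [C] serves all [n] and [m]. *)
Lemma card_planar_graphs_le (R : realType) (V : finType) (H : {set {set V}}) q :
  simple_graph H -> unicyclic H -> (0 < q)%N -> exists C : nat,
  forall n m, (n <= q * (n - m))%N -> (4 * q <= n)%N ->
  (#|planar_graphs R n m| <=
   C * #|[set G in planar_graphs R n m | ~~ has_copy H G]|)%N.
Proof.
move=> sH /andP[cH /eqP eH] q0.
have [|e0 e0H cH'] := connected_non_bridge cH; first by rewrite eH.
eexists; move=> n m hn le4q.
have n0 : (0 < n)%N by apply: leq_trans le4q; rewrite muln_gt0.
pose P := planar_graphs R n m.
pose B (G : {set {set 'I_n}}) := [set b | `[< bridge (2 * q)%N G b >]]%SET.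
have hP G : G \in P -> simple_graph G /\ #|G| = m.
  by rewrite inE => /and3P[? /eqP].
have := @card_copyfree _ q m P B _ _ _ _ _ _ V H e0 sH cH _ e0H cH' q0 eH.
rewrite -/P card_ord.
rewrite (_ : [set G in P | ~~ _]%SET = [set G in P | copies H G == finset.set0]%SET);
  last by apply/setP => G; rewrite !inE has_copyE negbK.
apply.
- by move=> G /hP[].
- by move=> G e b; exact: planar_switch.
- by move=> G b _; rewrite inE => /asboolP.
- move=> G /hP[sG cG].
  have [||B' [B'b leB']] := @many_bridges _ G q sG; rewrite ?card_ord ?cG //.
  rewrite card_ord in leB'; apply: leq_trans leB' _; rewrite leq_mul2l.
  apply/orP; right; apply/subset_leq_card/fintype.subsetP => b /B'b bb.
  by rewrite inE; apply/asboolP.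
(* If [m] exceeded [n], the truncated difference would vanish and force [n = 0]. *)
- have [//|mn] := leqP m n.
  by move: hn; rewrite (eqP (ltnW mn : n - m == 0)%N) muln0 leqNgt n0.
- exact: n0.
- by rewrite eH.
Qed.

(** The limit superior is at most the supremum of any tail; a uniform gap [d] keeps this below 1. *)
Lemma limn_esup_lt1 (R : realType) (u : R^nat) (N : nat) (d : R) : 0 < d ->
  (forall n, (N <= n)%N -> u n <= 1 - d) -> (limn_esup (fun n => (u n)%:E) < 1%:E)%E.
Proof.
move=> d0 hu; apply: (@le_lt_trans _ _ (1 - d)%:E); last by rewrite lte_fin ltrBlDr ltrDl.
rewrite /limn_esup /limf_esup.
apply: (@le_trans _ _ (ereal_sup [set (u n)%:E | n in [set n | (N <= n)%N]])).
  by apply: ereal_inf_lbound; exists [set n | (N <= n)%N] => //; exists N.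
by apply: ge_ereal_sup => _ [n /= Nn <-]; rewrite lee_fin hu.
Qed.

Theorem theorem5p2 (R : realType) (V : finType) (H : {set {set V}})
    (Hsimple : simple_graph H) (Hunicyclic : unicyclic H)
    (Hplanar : planar R H)
    (A : R) (A_lt1 : A < 1)
    (m : nat -> nat) (m_le : forall n : nat, (m n)%:R <= A * n%:R) :
  (limn_esup (fun n : nat => (Pr_planar R (m n) (@has_copy V 'I_n H))%:E)
    < 1%:E)%E.
Proof.
pose q := Num.bound (1 - A)^-1.
have A1 : 0 < 1 - A by rewrite subr_gt0.
have hq : (1 - A)^-1 < q%:R by apply: archi_boundP; rewrite invr_ge0 ltW.
have q0 : (0 < q)%N by rewrite -(ltr_nat R); apply: lt_trans hq; rewrite invr_gt0.
(* Indeed [n - m n] is at least [(1 - A) * n], and [q * (1 - A)] is at least 1. *)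
have hn n : (n <= q * (n - m n))%N.
  have h0 : (0 : R) <= n%:R by [].
  have mn : (m n <= n)%N by rewrite -(ler_nat R); apply: le_trans (m_le n) _; nra.
  rewrite -(ler_nat R) natrM natrB //.
  have h1 : 1 <= q%:R * (1 - A) by rewrite -ler_pdivrMr // div1r ltW.
  have := m_le n; have : (0 : R) < q%:R by rewrite ltr0n.
  nra.
have [C hC] := card_planar_graphs_le R Hsimple Hunicyclic q0.
(* Copy-free graphs have proportion at least [1 / C]; the successor keeps the gap defined for
   [C = 0]. *)
apply: (@limn_esup_lt1 _ _ (4 * q) (C.+1%:R)^-1); first by rewrite invr_gt0 ltr0Sn.
move=> n hn4; rewrite /Pr_planar; have := hC n (m n) (hn n) hn4.
set P := planar_graphs R n (m n).
have -> : #|P| = (#|[set G in P | has_copy H G]%SET| +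
                  #|[set G in P | ~~ has_copy H G]%SET|)%N.
  rewrite -(cardsID [set G | has_copy H G]%SET P); congr (_ + _)%N.
    by apply: eq_card => G; rewrite !inE.
  by apply: eq_card => G; rewrite !inE andbC.
move: #|_| #|_| => b a.
rewrite -(ler_nat R) natrM !natrD.
have a0 : (0 : R) <= a%:R by []. have b0 : (0 : R) <= b%:R by [].
have C0 : (0 : R) <= C%:R by [].
have C1 : (0 : R) < C.+1%:R by [].
(* For an empty class the quotient is 0, as the inverse of 0 is 0. *)
have [ab0|ab0] := eqVneq (a%:R + b%:R : R) 0.
  by rewrite ab0 invr0 mulr0 subr_ge0 invf_le1 // ler1n.
have abp : (0 : R) < a%:R + b%:R by rewrite lt_neqAle eq_sym ab0 addr_ge0.
move=> h; rewrite ler_pdivrMr // mulrBl mul1r lerBrDr lerD2l.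
rewrite mulrC ler_pdivrMr // -natr1; nra.
Qed.
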